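(* Let $\{t_k\}_{k\in\mathbb N}$ be a decreasing sequence of nonnegative real numbers such that $t_k\to0$ as $k\to\infty$ and $\sum_{k=1}^\infty \frac{t_k}{k}<\infty$. Then $$\sum_{\substack{k=1\\ k\ne n}}^\infty\frac{t_k}{|k-n|}\longrightarrow 0,\qquad n\to\infty .$$
   Context: $\mathbb N=\{1,2,3,\dots\}$. *)

(* Defs.v *)
From mathcomp Require Import all_boot all_order all_algebra all_classical all_reals all_analysis.

(* Main.v *)
Require Import Defs.
From mathcomp Require Import all_boot all_order all_algebra.
From mathcomp Require Import all_classical all_reals all_analysis.
From mathcomp Require Import zify ring.
Import Order.TTheory GRing.Theory Num.Theory.
Import numFieldNormedType.Exports.
Local Open Scope classical_set_scope.
Local Open Scope ring_scope.

(** Folding the series at [k = n] bounds it by a single series indexed by one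
    distance [j], whose terms are dominated by the summable sequence
    [3 * (t j / j)] and tend to [0] for each fixed [j]; dominated convergence
    for series ([tannery_cvg0]) then gives the limit. Each [k <> n] yields a
    term [t k / |k - n|] of one of three kinds.
    - If [k > n], put [k = n + j]: then [t (n + j) / j <= t j / j].
    - If [k <= n / 2], put [k = j]: then [n - j >= j], so
      [t j / (n - j) <= t j / j].
    - If [n / 2 < k < n], put [k = n - j]: then [n - j >= j], so
      [t (n - j) / j <= t j / j].

    In the first and the last case the term tends to [0] because [t] does, in
    the second because [n - j] tends to infinity. The estimates are
    [folded_term_bound] and [folded_term_cvg0], the comparison of the two series
    is [punctured_series_le]. Halving the range below [n] is what lets
    [t j / j] dominate there: it takes for [j] the smaller of [k] and
    [n - k]. *)

(** Tannery's theorem with limit zero: dominated convergence for the counting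
    measure. *)
Lemma tannery_cvg0 (R : realType) (f : nat -> nat -> R) (b : nat -> R) :
  (forall n j, 0 <= f n j <= b j) ->
  (forall j, f n j @[n --> \oo] --> 0) ->
  (\sum_(j <oo) (b j)%:E < +oo)%E ->
  (\sum_(j <oo) (f n j)%:E)%E @[n --> \oo] --> (0 : \bar R)%E.
Proof.
move=> fb f0 bfin.
have b0 j : 0 <= b j by have /andP[/le_trans] := fb 0%N j; apply.
have ib : (@counting nat R).-integrable setT (EFin \o b).
  apply/integrableP; split => //.
  rewrite ge0_integral_count//.
  by under eq_eseriesr do rewrite /= ger0_norm//.
have := @dominated_convergence _ _ _ (@counting nat R) setT measurableT
  (fun n j => (f n j)%:E) (fun=> 0%E) (EFin \o b).
case => //.
- apply: aeW => j _; apply: cvg_EFin; first exact: nearW.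
  exact: f0.
- apply: aeW => j n _ /=; have /andP[fn0 fnb] := fb n j.
  by rewrite lee_fin ger0_norm.
move=> _ _; rewrite integral0; apply: cvg_trans; apply: near_eq_cvg.
apply: nearW => n /=; rewrite ge0_integral_count// => j.
by rewrite lee_fin; case/andP: (fb n j).
Qed.

(** All the terms of the punctured series at [n] attached to the index [j]:
    the one at distance [j] to the right of [n], the one at position [j] in the
    lower half of the range below [n], and the one at distance [j] to the left
    of [n] in its upper half. At [j = 0] the convention [x / 0 = 0] makes the
    first and the last summand vanish; the second would be [t 0 / n], hence its
    guard. *)
Definition folded_term {R : realType} (t : nat -> R) (n j : nat) : R :=
  t (n + j)%N / j%:R
  + (if (0 < j)%N && (j.*2 <= n)%N then t j / (n - j)%N%:R else 0)
  + (if (j.*2 < n)%N then t (n - j)%N / j%:R else 0).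

Section nonincreasing.
Variables (R : realType) (t : nat -> R).
Hypothesis t_ge0 : forall k : nat, (1 <= k)%N -> 0 <= t k.
Hypothesis t_decr : forall k l : nat, (1 <= k)%N -> (k <= l)%N -> t l <= t k.

Let div_ge0 (k j : nat) : (0 < j -> 0 < k)%N -> 0 <= t k / j%:R.
Proof.
case: j => [|j] k0; first by rewrite invr0 mulr0.
by rewrite divr_ge0 ?ler0n// t_ge0// k0.
Qed.

Let right_ge0 n j : 0 <= t (n + j)%N / j%:R.
Proof. by apply: div_ge0; lia. Qed.

Let low_ge0 n j :
  0 <= if (0 < j)%N && (j.*2 <= n)%N then t j / (n - j)%N%:R else 0 :> R.
Proof. by case: ifP => // /andP[j0 _]; apply: div_ge0. Qed.

Let high_ge0 n j : 0 <= if (j.*2 < n)%N then t (n - j)%N / j%:R else 0 :> R.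
Proof. by case: ifP => // jn; apply: div_ge0; lia. Qed.

(** Each of the three summands is at most [t j / j]: either its numerator is a
    value of [t] at or beyond [j], or its denominator [n - j] is at least [j]. *)
Lemma folded_term_bound n j : 0 <= folded_term t n j <= 3 * (t j / j%:R).
Proof.
rewrite /folded_term !addr_ge0 ?right_ge0 ?low_ge0 ?high_ge0//=.
case: j => [|j].
  by rewrite /= invr0 !mulr0 !addr0 if_same.
have J : 0 <= t j.+1 / j.+1%:R by apply: div_ge0.
rewrite [leRHS](_ : _ = t j.+1 / j.+1%:R + t j.+1 / j.+1%:R + t j.+1 / j.+1%:R);
  last by ring.
have le_num k : (j.+1 <= k)%N -> t k / j.+1%:R <= t j.+1 / j.+1%:R.
  by move=> jk; rewrite ler_pM2r ?invr_gt0 ?ltr0n//; apply: t_decr.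
rewrite !lerD//.
- by apply: le_num; lia.
- case: ifP => // /andP[_ jn]; rewrite ler_wpM2l ?t_ge0//.
  by rewrite lef_pV2 ?posrE ?ltr0n ?ler_nat; lia.
- by case: ifP => // jn; apply: le_num; lia.
Qed.

Lemma folded_term_cvg0 j : t k @[k --> \oo] --> 0 ->
  folded_term t n j @[n --> \oo] --> 0.
Proof.
move=> t0; rewrite /folded_term.
rewrite -[X in _ --> X]addr0 -[X in X + _]addr0.
apply: cvgD; first apply: cvgD.
- rewrite -[X in _ --> X](mul0r (j%:R^-1)).
  by apply: cvgM; [rewrite cvg_shiftn|exact: cvg_cst].
- apply: (@squeeze_cvgr _ _ _ _ (fun=> 0) (fun n => 4 * `|t j| * n.+1%:R^-1)).
  (* The guard gives n - j >= n / 2, hence 4 * (n - j) >= n + 1. *)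
  + near=> n; rewrite low_ge0/=; case: ifPn => [/andP[j0 jn]|_].
      have tj := t_ge0 _ j0; rewrite ger0_norm//.
      have -> : 4 * t j * n.+1%:R^-1 = t j * (4 * n.+1%:R^-1) by ring.
      rewrite ler_wpM2l// -[leLHS]mul1r ler_pdivrMr ?ltr0n; last by lia.
      rewrite mulrAC ler_pdivlMr ?ltr0n// mul1r -natrM ler_nat; lia.
    by rewrite !mulr_ge0// invr_ge0.
  + exact: cvg_cst.
  + rewrite -[X in _ --> X](mulr0 (4 * `|t j|));
    by apply: cvgM; [exact: cvg_cst|exact: cvg_harmonic].
- have : t (n - j)%N / j%:R @[n --> \oo] --> 0.
    rewrite -[X in _ --> X](mul0r (j%:R^-1)).
    by apply: cvgM; [rewrite cvg_centern|exact: cvg_cst].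
  apply: cvg_trans; apply: near_eq_cvg; near=> n.
  by rewrite ifT//; near: n; exact: nbhs_infty_gt.
Unshelve. all: by end_near. Qed.

(** The part of the series above [n] is shifted to start at [n]; the finite part
    below [n] is cut at [n / 2], and its upper half is reversed by
    [k |-> n - k]. *)
Lemma punctured_series_le n :
  (\sum_(1 <= k <oo | k != n) (t k / `|k%:R - n%:R|)%R%:E
   <= \sum_(j <oo) (folded_term t n j)%:E)%E.
Proof.
pose G k : R :=
  if (k != n) && (1 <= k)%N then t k / `|k%:R - n%:R| else 0.
have G_ge0 k : 0 <= G k.
  by rewrite /G; case: ifP => // /andP[_ k0]; rewrite divr_ge0// t_ge0.
pose low j : R := if (0 < j)%N && (j.*2 <= n)%N then t j / (n - j)%N%:R else 0.
pose high j : R := if (j.*2 < n)%N then t (n - j)%N / j%:R else 0.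
rewrite [leLHS](_ : _ = \sum_(k <oo) (G k)%:E)%E; last first.
  rewrite eseries_cond eseries_mkcond; apply: eq_eseriesr => k _.
  by rewrite /G; case: ifP.
rewrite (nneseries_split 0 n) ?add0n//; last by move=> *; rewrite lee_fin.
rewrite -nneseries_addn; last by move=> *; rewrite lee_fin.
rewrite [leRHS](_ : _ = \sum_(j <oo) (t (n + j)%N / j%:R)%:E +
   \sum_(j <oo) (low j)%:E + \sum_(j <oo) (high j)%:E)%E; last first.
  by rewrite -!nneseriesD// => j _ _;
    rewrite -?EFinD lee_fin ?addr_ge0 ?right_ge0 ?low_ge0 ?high_ge0.
rewrite addeC -addeA leeD//.
  apply: lee_nneseries => i; first by rewrite lee_fin.
  rewrite lee_fin /G addnC; case: ifP => _ _; last exact: right_ge0.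
  by rewrite natrD addrAC subrr add0r normr_nat.
(* Summing to n inclusive makes the reversal exactly j |-> n - j; the extra
   terms are nonnegative. *)
apply: (@le_trans _ _ (\sum_(0 <= j < n.+1) (low j)%:E
                      + \sum_(0 <= j < n.+1) (high j)%:E)%E); last first.
  by apply: leeD; apply: nneseries_lim_ge => *; rewrite lee_fin
    ?low_ge0 ?high_ge0.
rewrite [X in (_ <= _ + X)%E]big_nat_rev/= -big_split/=.
rewrite big_nat_recr//= -[leLHS]adde0; apply: leeD; last first.
  by rewrite -EFinD lee_fin addr_ge0 ?low_ge0 ?high_ge0.
rewrite big_nat_cond [leRHS]big_nat_cond; apply: lee_sum => k.
rewrite andbT add0n subSS => /andP[_ kn]; rewrite -EFinD lee_fin /G.
case: ifP => [/andP[_ k0]|_]; last by rewrite addr_ge0 ?low_ge0 ?high_ge0.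
rewrite distrC -natrB ?(ltnW kn)// normr_nat.
have [nk|kn2] := leqP k.*2 n.
  by rewrite /low k0 nk/= lerDl high_ge0.
rewrite /high subKn ?(ltnW kn)// ifT ?lerDr ?low_ge0//; lia.
Qed.

End nonincreasing.

(* Sequences indexed by {1, 2, 3, ...} are functions on nat whose value at 0
   is irrelevant. The series have nonnegative terms and are summed in \bar R. *)
Theorem mainTheorem5 (R : realType) (t : nat -> R)
  (t_ge0 : forall k : nat, (1 <= k)%N -> 0 <= t k)
  (t_decr : forall k l : nat, (1 <= k)%N -> (k <= l)%N -> t l <= t k)
  (t_cvg0 : t k @[k --> \oo] --> (0 : R))
  (t_sum : (\sum_(1 <= k <oo) (t k / k%:R)%:E < +oo)%E) :
  (\sum_(1 <= k <oo | k != n) (t k / `|k%:R - n%:R|)%R%:E)%E @[n --> \oo]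
    --> (0 : \bar R)%E.
Proof.
have tk_ge0 k : 0 <= t k / k%:R.
  by case: k => [|k]; rewrite ?invr0 ?mulr0// divr_ge0// t_ge0.
apply: (@squeeze_cvge _ _ _ _ (fun=> 0%E) _
  (fun n => \sum_(j <oo) (folded_term t n j)%:E)%E).
- apply: nearW => n; rewrite punctured_series_le// andbT.
  by apply: nneseries_ge0 => k k1 _; rewrite lee_fin divr_ge0// t_ge0.
- exact: cvg_cst.
- apply: (@tannery_cvg0 _ _ (fun j => 3 * (t j / j%:R))).
  + exact: folded_term_bound.
  + by move=> j; exact: folded_term_cvg0.
  + under eq_eseriesr do rewrite EFinM.
    rewrite nneseriesZl//; last by move=> *; rewrite lee_fin.
    rewrite lte_mul_pinfty// (le_lt_trans _ t_sum)//.
    rewrite [leRHS]eseries_cond [leRHS]eseries_mkcond.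
    apply: lee_nneseries => [k _ _|[|k] _]; first by rewrite lee_fin.
      by rewrite invr0 mulr0.
    by [].
Qed.
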